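(* Let $\omega=e^{2\pi i/3}$, let $\alpha\in\mathbf{Q}(\omega)$, and let $\lambda=\frac13(1+2\omega)(1-\alpha)$. Write $\lambda=-a/b$ with $a,b\in\mathbf{Z}[\omega]$ relatively prime, $b\neq0$, and run the following variant of Euclid's algorithm in $\mathbf{Z}[\omega]$: set $r_{-1}=a$, $r_0=b$, and choose successively $q_j,r_j\in\mathbf{Z}[\omega]$ with $$r_{j-2}=q_jr_{j-1}-r_j,\qquad N(r_j)<N(r_{j-1}),\qquad j=1,2,\ldots,M,$$ until $r_M=0$. For $q=m+n\omega$ ($m,n\in\mathbf{Z}$) let $\mathcal{W}_q=S_4\,U_4^{\,n}\,S_4^{-1}\,U_4^{-m}\,B_4$ (composition of birational maps of $\mathbf{P}^2$). Then the birational transformation $$\mathcal{A}=\mathcal{W}_{q_M}\circ\cdots\circ\mathcal{W}_{q_1}$$ of $\mathbf{P}^2$ maps the foliation $\mathcal{F}^4_\alpha$ to the foliation $\mathcal{F}^4_\infty$. In particular, the pull-back by $\mathcal{A}$ of the rational first integral $(y^3-z^3)/(x^3-z^3)$ of $\mathcal{F}^4_\infty$ is a rational first integral of $\mathcal{F}^4_\alpha$.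
   Context: $N(m+n\omega)=m^2-mn+n^2$ is the norm on the Euclidean ring $\mathbf{Z}[\omega]$. For $\alpha\in\mathbf{C}$, $\mathcal{F}^4_\alpha$ is the foliation on the complex projective plane $\mathbf{P}^2$ given by the kernel of $(y^3-z^3)(yz-\alpha x^2)\,dx+(z^3-x^3)(xz-\alpha y^2)\,dy+(x^3-y^3)(xy-\alpha z^2)\,dz$, and $\mathcal{F}^4_\infty$ is given by the kernel of $(y^3-z^3)x^2\,dx+(z^3-x^3)y^2\,dy+(x^3-y^3)z^2\,dz$. The birational maps are $$B_4(x:y:z)=(\omega^2x+\omega y+z:\omega x+\omega^2y+z:x+y+z),$$ $$S_4(x:y:z)=(y^2-\omega xz:x^2-\omega yz:z^2-\omega xy),$$ $$\begin{aligned}U_4(x:y:z)=\big(&(xy+xz+\omega yz)(x+y+\omega^2z)(x+\omega^2y+z):\\ &(\omega xz+xy+yz)(\omega^2x+y+z)(x+y+\omega^2z):\\ &(xz+yz+\omega xy)(x+\omega^2y+z)(\omega^2x+y+z)\big).\end{aligned}$$ A rational first integral of a foliation is a nonconstant rational function constant along its leaves. *)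

(* Defs.v *)
From HB Require Import structures.
From mathcomp Require Import all_boot all_order all_algebra ring lra.
From mathcomp Require Import complex mpoly.
From mathcomp Require Import classical_sets reals topology normedtype.
From mathcomp Require Import derive trigo.

Set Implicit Arguments.
Unset Strict Implicit.
Unset Printing Implicit Defensive.

Import Order.TTheory GRing.Theory Num.Theory.
Import numFieldNormedType.Exports.

Local Open Scope ring_scope.

Lemma ord3_ind (P : 'I_3 -> Prop) : P 0 -> P 1 -> P 2%:R -> forall i, P i.
Proof.
move=> P0 P1 P2 [[|[|[|//]]] hi].
- by have -> : Ordinal hi = 0 by apply: val_inj.
- by have -> : Ordinal hi = 1 by apply: val_inj.
- by have -> : Ordinal hi = 2%:R by apply: val_inj.
Qed.

Section ProjectivePlane.
Variable K : fieldType.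

Local Notation poly3 := {mpoly K[3]}.

Definition triple := 3.-tuple poly3.

Definition homog_triple (d : nat) (F : triple) : Prop :=
  forall i, tnth F i \is d.-homog.

Definition comp_triple (F G : triple) : triple :=
  [tuple tnth F i \mPo G | i < 3].

Definition id_triple : triple := [tuple 'X_i | i < 3].

(* G o F is the identity of P^2: its components are h x, h y, h z. *)
Definition retracts (G F : triple) : Prop :=
  exists2 h : poly3,
    h != 0 /\ (exists d, h \is d.-homog) &
    forall i, tnth (comp_triple G F) i = h * 'X_i.

(* Homogeneous coordinates are not required to be coprime, so that two
   birational maps coincide when their triples are proportional. *)
Record birmap := Birmap {
  bir_map : triple;
  bir_inv_map : triple;
  bir_homog : exists d, homog_triple d bir_map;
  bir_inv_homog : exists d, homog_triple d bir_inv_map;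
  bir_mapK : retracts bir_inv_map bir_map;
  bir_inv_mapK : retracts bir_map bir_inv_map
}.

Lemma comp_homog (p : poly3) (F : triple) d e :
  p \is d.-homog -> homog_triple e F -> p \mPo F \is (d * e).-homog.
Proof.
move=> /dhomogP hp hF; rewrite comp_mpolyE big_seq.
apply: rpred_sum => m /hp /= hm; apply: rpredZ.
rewrite -hm mdegE big_distrl /=.
elim: (index_enum _) => [|i s IH]; first by rewrite !big_nil dhomog1.
by rewrite !big_cons (mulnC (m i)); apply: dhomogM IH; apply: dhomogMn.
Qed.

Lemma comp_triple_homog F G d e :
  homog_triple d F -> homog_triple e G -> homog_triple (d * e) (comp_triple F G).
Proof. by move=> hF hG i; rewrite tnth_mktuple; apply: comp_homog. Qed.

Lemma comp_mpolyA (p : poly3) (F G : triple) :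
  (p \mPo F) \mPo G = p \mPo comp_triple F G.
Proof.
rewrite [p \mPo F]comp_mpolyE [RHS]comp_mpolyE raddf_sum /=.
apply: eq_bigr => m _; rewrite comp_mpolyZ rmorph_prod; congr (_ *: _).
by apply: eq_bigr => i _; rewrite rmorphXn /= tnth_mktuple.
Qed.

Lemma comp_scaled (p h : poly3) (F G : triple) d :
  p \is d.-homog -> (forall i, tnth F i = h * tnth G i) ->
  p \mPo F = h ^+ d * (p \mPo G).
Proof.
move=> /dhomogP hp hF; rewrite !comp_mpolyE mulr_sumr.
apply: eq_big_seq => m /hp /= hm.
rewrite -scalerAr; congr (_ *: _).
under eq_bigr do rewrite hF exprMn.
rewrite big_split -hm mdegE; congr (_ * _).
by rewrite -(big_morph (fun n => h ^+ n) (exprD h) (expr0 h)).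
Qed.

Lemma comp_neq0 (p : poly3) (F : birmap) d :
  p \is d.-homog -> p != 0 -> p \mPo bir_map F != 0.
Proof.
move=> hp p0; have [k [k0 _] hk] := bir_inv_mapK F.
apply/eqP => pF0.
have : (p \mPo bir_map F) \mPo bir_inv_map F = 0 by rewrite pF0 raddf0.
rewrite comp_mpolyA (@comp_scaled _ k _ id_triple _ hp); last first.
  by move=> i; rewrite hk tnth_mktuple.
by rewrite comp_mpoly_id => /eqP; rewrite mulf_eq0 expf_eq0 (negPf k0) (negPf p0) andbF.
Qed.

Definition bir_inv (F : birmap) : birmap :=
  Birmap (bir_inv_homog F) (bir_homog F) (bir_inv_mapK F) (bir_mapK F).

Lemma retracts_comp (F G : birmap) :
  retracts (comp_triple (bir_inv_map G) (bir_inv_map F))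
           (comp_triple (bir_map F) (bir_map G)).
Proof.
have [h [h0 [d hd]] hh] := bir_mapK F.
have [k [k0 [e he]] hk] := bir_mapK G.
have [a ha] := bir_inv_homog G.
have [b hb] := bir_homog G.
exists ((h \mPo bir_map G) ^+ a * k).
  split; first by rewrite mulf_neq0 // expf_neq0 // (comp_neq0 _ hd).
  exists (d * b * a + e)%N; apply: dhomogM he.
  by apply: dhomogMn; apply: comp_homog.
move=> i; rewrite -mulrA -hk !tnth_mktuple comp_mpolyA.
apply: comp_scaled; first exact: ha.
move=> j; rewrite tnth_mktuple -comp_mpolyA.
have := hh j; rewrite tnth_mktuple => ->.
by rewrite rmorphM /= comp_mpolyXU -tnth_nth.
Qed.

Definition bir_comp (F G : birmap) : birmap.
Proof.
apply: (@Birmap (comp_triple (bir_map F) (bir_map G))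
  (comp_triple (bir_inv_map G) (bir_inv_map F))).
- have [d hd] := bir_homog F; have [e he] := bir_homog G.
  by exists (d * e)%N; apply: comp_triple_homog.
- have [d hd] := bir_inv_homog G; have [e he] := bir_inv_homog F.
  by exists (d * e)%N; apply: comp_triple_homog.
- exact: retracts_comp.
- exact: (retracts_comp (bir_inv G) (bir_inv F)).
Defined.

Lemma id_triple_homog : exists d, homog_triple d id_triple.
Proof. by exists 1%N => i; rewrite tnth_mktuple dhomogX /= mdeg1. Qed.

Lemma id_triple_retracts : retracts id_triple id_triple.
Proof.
exists 1; first by split; [exact: oner_neq0 | exists 0%N; exact: dhomog1].
by move=> i; rewrite mul1r tnth_mktuple comp_mpoly_id tnth_mktuple.
Qed.

Definition bir_id : birmap :=
  Birmap id_triple_homog id_triple_homog id_triple_retracts id_triple_retracts.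

Definition bir_expz (F : birmap) (n : int) : birmap :=
  match n with
  | Posz k => iter k (bir_comp F) bir_id
  | Negz k => iter k.+1 (bir_comp (bir_inv F)) bir_id
  end.

Record ratfun := Ratfun {
  rf_num : poly3;
  rf_den : poly3;
  rf_homog : exists d, (rf_num \is d.-homog) /\ (rf_den \is d.-homog);
  rf_den_neq0 : rf_den != 0
}.

Definition rf_nonconstant (H : ratfun) : Prop :=
  ~ exists c : K, rf_num H = c *: rf_den H.

Definition rf_pullback (A : birmap) (H : ratfun) : ratfun.
Proof.
apply: (@Ratfun (rf_num H \mPo bir_map A) (rf_den H \mPo bir_map A)).
- have [d [hn hd]] := rf_homog H; have [e he] := bir_homog A.
  by exists (d * e)%N; split; apply: comp_homog.
- have [d [_ hd]] := rf_homog H.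
  exact: comp_neq0 hd (rf_den_neq0 H).
Defined.

(* A triple (A, B, C) stands for the 1-form A dx + B dy + C dz. *)
Definition contract (om v : triple) : poly3 :=
  \sum_(i < 3) tnth om i * tnth v i.

(* A form on C^3 defines a foliation of P^2 when it is homogeneous, nonzero and
   kills the radial vector field; it is then integrable. *)
Record foliation := Foliation {
  fol_form : triple;
  fol_homog : exists d, homog_triple d.+1 fol_form;
  fol_radial : contract fol_form id_triple = 0;
  fol_neq0 : exists i, tnth fol_form i != 0
}.

Definition form_pullback (F om : triple) : triple :=
  [tuple \sum_(i < 3) (tnth om i \mPo F) * (tnth F i)^`M(j) | j < 3].

(* A form matters only through its kernel. Since A is birational, A maps F to G
   exactly when the pull-back of G by A has the same kernel as F. *)
Definition maps_foliation (A : birmap) (F G : foliation) : Prop :=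
  forall v : triple,
    contract (fol_form F) v = 0 <->
    contract (form_pullback (bir_map A) (fol_form G)) v = 0.

End ProjectivePlane.

Section Maps.
Variable K : fieldType.
Local Notation poly3 := {mpoly K[3]}.
Local Notation x := ('X_(0 : 'I_3) : poly3).
Local Notation y := ('X_(1 : 'I_3) : poly3).
Local Notation z := ('X_(2%:R : 'I_3) : poly3).

Definition B4_triple (w : K) : triple K :=
  [tuple (w ^+ 2)%:MP * x + w%:MP * y + z;
         w%:MP * x + (w ^+ 2)%:MP * y + z;
         x + y + z].

Definition S4_triple (w : K) : triple K :=
  [tuple y ^+ 2 - w%:MP * x * z; x ^+ 2 - w%:MP * y * z; z ^+ 2 - w%:MP * x * y].

Definition U4_triple (w : K) : triple K :=
  [tuple
    (x * y + x * z + w%:MP * y * z) * (x + y + (w ^+ 2)%:MP * z)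
      * (x + (w ^+ 2)%:MP * y + z);
    (w%:MP * x * z + x * y + y * z) * ((w ^+ 2)%:MP * x + y + z)
      * (x + y + (w ^+ 2)%:MP * z);
    (x * z + y * z + w%:MP * x * y) * (x + (w ^+ 2)%:MP * y + z)
      * ((w ^+ 2)%:MP * x + y + z)].

Lemma homogX (i : 'I_3) : ('X_i : poly3) \is 1.-homog.
Proof. by rewrite dhomogX /= mdeg1. Qed.

Lemma homogCM (c : K) (p : poly3) d : p \is d.-homog -> c%:MP * p \is d.-homog.
Proof. by move=> hp; rewrite mul_mpolyC; apply: rpredZ. Qed.

Lemma homogM (p q : poly3) d e k :
  p \is d.-homog -> q \is e.-homog -> (d + e)%N = k -> p * q \is k.-homog.
Proof. by move=> hp hq <-; apply: dhomogM. Qed.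

Lemma homogCX (c : K) (i : 'I_3) : c%:MP * 'X_i \is 1.-homog.
Proof. exact/homogCM/homogX. Qed.

Lemma B4_homog (w : K) : exists d, homog_triple d (B4_triple w).
Proof.
exists 1%N; elim/ord3_ind; rewrite (tnth_nth 0) /=;
  by rewrite !rpredD ?homogX ?homogCX.
Qed.

Lemma S4_homog (w : K) : exists d, homog_triple d (S4_triple w).
Proof.
exists 2%N; elim/ord3_ind; rewrite (tnth_nth 0) /= expr2 rpredB //;
  by apply: (@homogM _ _ 1 1); rewrite ?homogX ?homogCX.
Qed.

Lemma U4_homog (w : K) : exists d, homog_triple d (U4_triple w).
Proof.
exists 4%N; elim/ord3_ind; rewrite (tnth_nth 0) /=;
  (apply: (@homogM _ _ 3 1) => //; [apply: (@homogM _ _ 2 1) => //|]);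
  rewrite !rpredD ?homogX ?homogCX //;
  by apply: (@homogM _ _ 1 1); rewrite ?homogX ?homogCX.
Qed.

Variable w : K.
Hypothesis hw : w ^+ 2 + w + 1 = 0.

Let hW : (w%:MP : poly3) ^+ 2 = - w%:MP - 1.
Proof.
have -> : - (w%:MP : poly3) - 1 = (- w - 1)%:MP.
  by rewrite mpolyCB mpolyCN mpolyC1.
rewrite -rmorphXn /=; congr (_%:MP).
by apply/eqP; rewrite -subr_eq0 -hw; apply/eqP; ring.
Qed.

Let sqC : ((w ^+ 2)%:MP : poly3) = - w%:MP - 1.
Proof. by rewrite rmorphXn. Qed.

Let quadC : (((w ^+ 2) ^+ 2)%:MP : poly3) = w%:MP.
Proof. by rewrite !rmorphXn /= hW; ring: hW. Qed.

Lemma B4_retracts : 3%:R != 0 :> K -> retracts (B4_triple (w ^+ 2)) (B4_triple w).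
Proof.
move=> h3; exists (3%:R)%:MP.
  split; first by rewrite mpolyC_eq0.
  exists 0%N; rewrite -[_%:MP]mulr1; exact/homogCM/dhomog1.
elim/ord3_ind; rewrite tnth_mktuple (tnth_nth 0) /=;
 rewrite ?quadC ?sqC !(rmorphB, rmorphN, rmorph1, rmorphD, rmorphM) /= ?comp_mpolyC !comp_mpolyXU /=
   ?sqC ?rmorphMn /= ?mpolyC1; ring: hW.
Qed.


Lemma mpoly_neq0 (p : poly3) (v : 'I_3 -> K) : p.@[v] != 0 -> p != 0.
Proof. by apply: contra_neq => ->; rewrite meval0. Qed.

Lemma S4_retracts : retracts (S4_triple (w ^+ 2)) (S4_triple w).
Proof.
pose h : poly3 := x * x * x + y * y * y + z * z * z - (3%:R * w)%:MP * (x * y * z).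
exists h.
  split.
    apply: (@mpoly_neq0 _ (fun i => (i == 0)%:R)).
    by rewrite /h !(mevalD, mevalN, mevalM, mevalC, mevalXU) /= !(mulr0, mul0r, mulr1, addr0, subr0, oppr0) oner_neq0.
  exists 3%N; rewrite !rpredD ?rpredN //; try (apply: homogCM);
    by apply: (@homogM _ _ 2 1); rewrite ?homogX //; apply: (@homogM _ _ 1 1); rewrite ?homogX.
elim/ord3_ind; rewrite tnth_mktuple (tnth_nth 0) /= /h;
 rewrite ?sqC !(rmorphB, rmorphN, rmorph1, rmorphD, rmorphXn, rmorphM) /= ?comp_mpolyC !comp_mpolyXU /= ?sqC ?rmorphMn /= ?mpolyC1; ring: hW.
Qed.

Lemma U4_retracts : 2%:R != 0 :> K -> 3%:R != 0 :> K ->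
  retracts (U4_triple (w ^+ 2)) (U4_triple w).
Proof.
move=> h2 h3.
pose W : poly3 := w%:MP.
pose l1 : poly3 := W ^+ 2 * x + y + z.
pose l2 : poly3 := x + W ^+ 2 * y + z.
pose l3 : poly3 := x + y + W ^+ 2 * z.
pose u1 := (x * y + x * z + W * y * z) * l3 * l2.
pose u2 := (W * x * z + x * y + y * z) * l1 * l3.
pose u3 := (x * z + y * z + W * x * y) * l2 * l1.
pose m1 := W * u1 + u2 + u3.
pose m2 := u1 + W * u2 + u3.
pose m3 := u1 + u2 + W * u3.
have e1 : u1 * u2 + u1 * u3 + W ^+ 2 * u2 * u3 = l1 * l2 * l3 * x * m1.
  by rewrite /m1 /u1 /u2 /u3 /l1 /l2 /l3; ring: (hW : W ^+ 2 = - W - 1).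
have e2 : W ^+ 2 * u1 * u3 + u1 * u2 + u2 * u3 = l1 * l2 * l3 * y * m2.
  by rewrite /m2 /u1 /u2 /u3 /l1 /l2 /l3; ring: (hW : W ^+ 2 = - W - 1).
have e3 : u1 * u3 + u2 * u3 + W ^+ 2 * u1 * u2 = l1 * l2 * l3 * z * m3.
  by rewrite /m3 /u1 /u2 /u3 /l1 /l2 /l3; ring: (hW : W ^+ 2 = - W - 1).
exists (l1 * l2 * l3 * (m1 * m2 * m3)).
  split; last first.
    have [d hu] := U4_homog w.
    have homu : (u1 \is d.-homog) /\ (u2 \is d.-homog) /\ (u3 \is d.-homog).
      have := (hu 0, hu 1, hu 2%:R); rewrite !(tnth_nth 0) /= rmorphXn /=.
      by move=> [[? ?] ?].
    have [h_1 [h_2 h_3]] := homu.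
    have hl : (l1 \is 1.-homog) /\ (l2 \is 1.-homog) /\ (l3 \is 1.-homog).
      by rewrite /l1 /l2 /l3 /W -rmorphXn /= !rpredD ?homogX ?homogCX.
    have hm : (m1 \is d.-homog) /\ (m2 \is d.-homog) /\ (m3 \is d.-homog).
      by rewrite /m1 /m2 /m3 !rpredD ?homogCM.
    have [? [? ?]] := hl; have [? [? ?]] := hm.
    by exists (1 + 1 + 1 + (d + d + d))%N; do ?apply: dhomogM.
  apply: (@mpoly_neq0 _ (fun i => (i != 2%:R)%:R)).
  rewrite /m1 /m2 /m3 /u1 /u2 /u3 /l1 /l2 /l3 /W.
  rewrite !(mevalD, mevalM, rmorphXn, mevalC, mevalXU) /=.
  set t := (X in X != 0).
  have -> : t = - (2%:R * (3%:R * (3%:R * 3%:R))).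
    have hw2 : w ^+ 2 = - w - 1 by apply/eqP; rewrite -subr_eq0 -hw; apply/eqP; ring.
    by rewrite /t; ring: hw2.
  by rewrite oppr_eq0 !mulf_neq0.
elim/ord3_ind; rewrite tnth_mktuple (tnth_nth 0) /=;
 rewrite ?quadC ?sqC !(rmorphB, rmorphN, rmorph1, rmorphD, rmorphM) /= ?comp_mpolyC !comp_mpolyXU /= ?sqC -?hW -/W -/l1 -/l2 -/l3 -/u1 -/u2 -/u3;
 rewrite ?e1 ?e2 ?e3 -/m1 -/m2 -/m3; clearbody l1 l2 l3 m1 m2 m3; ring.
Qed.
End Maps.

Local Open Scope complex_scope.

Section Complex.
Variable R : realType.
Local Notation C := (R[i]).
Local Notation x := ('X_(0 : 'I_3) : {mpoly C[3]}).
Local Notation y := ('X_(1 : 'I_3) : {mpoly C[3]}).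
Local Notation z := ('X_(2%:R : 'I_3) : {mpoly C[3]}).

Definition omega : C := cos (2 * pi / 3) +i* sin (2 * pi / 3).

Lemma omegaE : omega ^+ 2 + omega + 1 = 0.
Proof.
rewrite /omega; set t := 2 * pi / 3; set c := cos t; set s := sin t.
have t3 : t + t + t = pi *+ 2 by rewrite /t; field.
have s0 : s != 0.
  rewrite gt_eqF // sin_gt0_pi // /t; have := @pi_gt0 R; lra.
have hcs : s ^+ 2 = 1 - c ^+ 2 by rewrite sin2cos2.
have e1 : (s * c + c * s) * c + (c * c - s * s) * s = 0.
  by rewrite -sinD -cosD -sinD t3 sin2pi.
have e2 : (c * c - s * s) * c - (s * c + c * s) * s = 1.
  by rewrite -sinD -cosD -cosD t3 cos2pi.
have e3 : 4 * c ^+ 2 = 1.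
  apply: (mulfI s0); rewrite mulr1.
  have -> : s * (4 * c ^+ 2) = s * (c ^+ 2 + s ^+ 2) +
    ((s * c + c * s) * c + (c * c - s * s) * s) by ring.
  by rewrite e1 hcs; ring.
have e4 : c = - 2^-1.
  have := e2; have -> : (c * c - s * s) * c - (s * c + c * s) * s =
    c * (4 * c ^+ 2) - 3 * c by rewrite -!expr2; move: hcs; nra.
  by rewrite e3; lra.
have e5 : s * s = 3 / 4 by rewrite -expr2 hcs e4; field.
apply/eqP; rewrite eq_complex expr2 /=; apply/andP; split; apply/eqP.
  by rewrite e5 e4; field.
by rewrite e4; field.
Qed.

Definition in_Qomega (u : C) : Prop :=
  exists f g : {poly rat}, (map_poly ratr g).[omega] != 0 /\
    u = (map_poly ratr f).[omega] / (map_poly ratr g).[omega].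

Let omegaE2 : (omega ^+ 2) ^+ 2 + omega ^+ 2 + 1 = 0.
Proof.
have -> : (omega ^+ 2) ^+ 2 + omega ^+ 2 + 1 =
  (omega ^+ 2 + omega + 1) * (omega ^+ 2 - omega + 1) by ring.
by rewrite omegaE mul0r.
Qed.

Let omegaK : (omega ^+ 2) ^+ 2 = omega.
Proof.
apply/eqP; rewrite -subr_eq0; apply/eqP.
have -> : (omega ^+ 2) ^+ 2 - omega =
  (omega ^+ 2 + omega + 1) * (omega ^+ 2 - omega) by ring.
by rewrite omegaE mul0r.
Qed.

Let nat_neq0 n : n.+1%:R != 0 :> C.
Proof. by rewrite pnatr_eq0. Qed.

(* In each case the inverse is obtained by exchanging omega and omega ^+ 2. *)
Definition B4 : birmap C.
Proof.
apply: (@Birmap _ (B4_triple omega) (B4_triple (omega ^+ 2))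
  (B4_homog _) (B4_homog _) (B4_retracts omegaE (nat_neq0 2))).
by have := B4_retracts omegaE2 (nat_neq0 2); rewrite omegaK.
Defined.

Definition S4 : birmap C.
Proof.
apply: (@Birmap _ (S4_triple omega) (S4_triple (omega ^+ 2))
  (S4_homog _) (S4_homog _) (S4_retracts omegaE)).
by have := S4_retracts omegaE2; rewrite omegaK.
Defined.

Definition U4 : birmap C.
Proof.
apply: (@Birmap _ (U4_triple omega) (U4_triple (omega ^+ 2))
  (U4_homog _) (U4_homog _) (U4_retracts omegaE (nat_neq0 1) (nat_neq0 2))).
by have := U4_retracts omegaE2 (nat_neq0 1) (nat_neq0 2); rewrite omegaK.
Defined.

Definition F4_form (alpha : C) : triple C :=
  [tuple (y ^+ 3 - z ^+ 3) * (y * z - alpha%:MP * x ^+ 2);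
         (z ^+ 3 - x ^+ 3) * (x * z - alpha%:MP * y ^+ 2);
         (x ^+ 3 - y ^+ 3) * (x * y - alpha%:MP * z ^+ 2)].

Definition F4oo_form : triple C :=
  [tuple (y ^+ 3 - z ^+ 3) * x ^+ 2;
         (z ^+ 3 - x ^+ 3) * y ^+ 2;
         (x ^+ 3 - y ^+ 3) * z ^+ 2].

Lemma homogXn (i : 'I_3) n : ('X_i ^+ n : {mpoly C[3]}) \is n.-homog.
Proof. by have := dhomogMn n (homogX C i); rewrite mul1n. Qed.

Lemma homogXX (i j : 'I_3) : ('X_i * 'X_j : {mpoly C[3]}) \is 2.-homog.
Proof. by apply: (@homogM _ _ _ 1 1); rewrite ?homogX. Qed.

Definition F4 (alpha : C) : foliation C.
Proof.
apply: (@Foliation _ (F4_form alpha)).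
- exists 4%N; elim/ord3_ind; rewrite (tnth_nth 0) /=;
    by apply: (@homogM _ _ _ 3 2); rewrite // rpredB ?homogXn ?homogXX // homogCM // homogXn.
- rewrite /contract !big_ord_recl big_ord0 !tnth_mktuple !(tnth_nth 0) /=.
  rewrite (_ : lift _ _ = 1); last exact: val_inj.
  rewrite (_ : lift _ _ = 2%:R); last exact: val_inj.
  by ring.
- exists 0; rewrite (tnth_nth 0) /=.
  apply: (@mpoly_neq0 _ _ (fun i => [:: 0; 2%:R; 1]`_i)).
  rewrite !(mevalM, mevalD, mevalN, mevalC, rmorphXn, mevalXU) /=.
  set t := (X in X != 0); have -> : t = 14%:R by rewrite /t; ring.
  exact: nat_neq0 13.
Defined.

Definition F4oo : foliation C.
Proof.
apply: (@Foliation _ F4oo_form).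
- exists 4%N; elim/ord3_ind; rewrite (tnth_nth 0) /=;
    by apply: (@homogM _ _ _ 3 2); rewrite // ?rpredB ?homogXn.
- rewrite /contract !big_ord_recl big_ord0 !tnth_mktuple !(tnth_nth 0) /=.
  rewrite (_ : lift _ _ = 1); last exact: val_inj.
  rewrite (_ : lift _ _ = 2%:R); last exact: val_inj.
  by ring.
- exists 0; rewrite (tnth_nth 0) /=.
  apply: (@mpoly_neq0 _ _ (fun i => [:: 1; 1; 0]`_i)).
  rewrite !(mevalM, mevalD, mevalN, mevalC, rmorphXn, mevalXU) /=.
  set t := (X in X != 0); have -> : t = 1 by rewrite /t; ring.
  exact: oner_neq0.
Defined.

(* A holomorphic arc in C^3 \ 0, over the disc of center c and radius e, whose
   projection to P^2 stays in a leaf of F: it avoids the singular points of F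
   and its velocity lies in the kernel of the form. *)
Definition leaf_arc (F : foliation C) (c : C) (e : R) (g : C -> 'I_3 -> C) : Prop :=
  forall t : C, `|t - c| < e%:C ->
    [/\ forall i, derivable (fun s : C^o => g s i : C^o) (t : C^o) 1,
        exists i, (tnth (fol_form F) i).@[g t] != 0 &
        \sum_(i < 3) (tnth (fol_form F) i).@[g t]
           * 'D_1 (fun s : C^o => g s i : C^o) (t : C^o) = 0].

(* Testing on arcs suffices: a leaf minus the poles of H is connected and is
   covered by such arcs. *)
Definition constant_on_leaves (F : foliation C) (H : ratfun C) : Prop :=
  forall (c : C) (e : R) (g : C -> 'I_3 -> C), leaf_arc F c e g ->
    (forall t, `|t - c| < e%:C -> (rf_den H).@[g t] != 0) ->
    forall s t, `|s - c| < e%:C -> `|t - c| < e%:C ->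
      (rf_num H).@[g s] / (rf_den H).@[g s] =
      (rf_num H).@[g t] / (rf_den H).@[g t].

Definition rational_first_integral (F : foliation C) (H : ratfun C) : Prop :=
  rf_nonconstant H /\ constant_on_leaves F H.

Definition H4oo : ratfun C.
Proof.
apply: (@Ratfun _ (y ^+ 3 - z ^+ 3) (x ^+ 3 - z ^+ 3)).
- by exists 3%N; rewrite !rpredB ?homogXn.
- apply: (@mpoly_neq0 _ _ (fun i => [:: 1; 0; 0]`_i)).
  rewrite !(mevalM, mevalD, mevalN, mevalC, rmorphXn, mevalXU) /=.
  set t := (X in X != 0); have -> : t = 1 by rewrite /t; ring.
  exact: oner_neq0.
Defined.

(* The pair (m, n) stands for m + n omega. *)
Definition eisenstein := (int * int)%type.

Definition eis_val (q : eisenstein) : C := q.1%:~R + q.2%:~R * omega.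

Definition eis_norm (q : eisenstein) : int :=
  q.1 ^+ 2 - q.1 * q.2 + q.2 ^+ 2.

Definition eis_coprime (a b : eisenstein) : Prop :=
  forall d u v : eisenstein,
    eis_val a = eis_val d * eis_val u -> eis_val b = eis_val d * eis_val v ->
    exists e : eisenstein, eis_val d * eis_val e = 1.

(* The remainders r are indexed from -1. *)
Definition euclid_run (a b : eisenstein) (M : nat)
    (q : nat -> eisenstein) (r : int -> eisenstein) : Prop :=
  [/\ r (-1) = a, r 0 = b,
      forall j : nat, (1 <= j <= M)%N ->
        eis_val (r (j%:Z - 2)) =
          eis_val (q j) * eis_val (r (j%:Z - 1)) - eis_val (r j%:Z) /\
        eis_norm (r j%:Z) < eis_norm (r (j%:Z - 1)) &
      eis_val (r M%:Z) = 0].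

Definition W4 (q : eisenstein) : birmap C :=
  bir_comp S4 (bir_comp (bir_expz U4 q.2)
    (bir_comp (bir_inv S4) (bir_comp (bir_expz U4 (- q.1)) B4))).

Fixpoint W4_comp (q : nat -> eisenstein) (M : nat) : birmap C :=
  match M with
  | 0%N => bir_id C
  | M'.+1 => bir_comp (W4 (q M'.+1)) (W4_comp q M')
  end.

End Complex.

(* Main.v *)
Require Import Defs.
From HB Require Import structures.
From mathcomp Require Import all_boot all_order all_algebra ring.
From mathcomp Require Import complex mpoly.
From mathcomp Require Import boolp classical_sets reals topology normedtype.
From mathcomp Require Import derive trigo.

Import Order.TTheory GRing.Theory Num.Theory.
Import numFieldNormedType.Exports.
Local Open Scope ring_scope.
Local Open Scope complex_scope.

(** The forms of the F^4_alpha and F^4_oo make up a pencil; put theta = 1 + 2 omega,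
    so that theta^2 = -3. If lambda = -a/b, then F^4_alpha is cut out by
    b (P - Q) + theta a Q, where P and Q are the forms of F^4_0 and F^4_oo. Up to a
    nonzero polynomial factor, pull-back acts on the pencil by the linear
    substitutions B_4 : (a, b) -> (b, -a), S_4 : (a, b) -> (a, -omega b) and
    U_4 : (a, b) -> (a, b - a), hence W_q : (a, b) -> (b, q b - a), which is one step of
    the algorithm; the run ends at (a, 0), which is F^4_oo.

    For H = (y^3 - z^3)/(x^3 - z^3) = N/D the form D dN - N dD is -3 Q, so that after
    pull-back D dN - N dD is a multiple of the form of F^4_alpha. The derivative of H
    along a leaf is therefore zero. *)

(** Constants and variables generate the polynomial ring. This form of induction suits the chain
    rules below, which pass to sums and products. *)
Lemma mpoly_ring_ind (n : nat) (K : comNzRingType) (P : {mpoly K[n]} -> Prop) :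
  (forall c, P c%:MP) -> (forall i, P 'X_i) ->
  (forall p q, P p -> P q -> P (p + q)) ->
  (forall p q, P p -> P q -> P (p * q)) -> forall p, P p.
Proof.
move=> PC PX PD PM.
have P1 : P 1 by rewrite -mpolyC1.
apply: mpolyind => [|c m p _ _ Pp]; first by rewrite -mpolyC0.
apply: (PD) => //; rewrite -mul_mpolyC mpolyXE_id; apply: (PM) => //.
apply: (big_ind P P1 PM) => i _; elim: (m i) => [|k IH]; first by rewrite expr0.
by rewrite exprS; apply: (PM).
Qed.

(** * Pull-back of 1-forms by polynomial and birational maps *)

Section Pullback.
Set Implicit Arguments.
Unset Strict Implicit.
Variable K : fieldType.
Local Notation poly3 := {mpoly K[3]}.
Implicit Types (p q h : poly3) (F G om : triple K).

Lemma sum3 (V : nmodType) (f : 'I_3 -> V) : \sum_(i < 3) f i = f 0 + f 1 + f 2%:R.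
Proof.
rewrite !big_ord_recl big_ord0 addr0 addrA.
by congr (_ + f _ + f _); apply: val_inj.
Qed.

Lemma mderivXU (i j : 'I_3) : ('X_i : poly3)^`M(j) = (i == j)%:R.
Proof.
rewrite mderivX mnm1E; case: eqP => [->|_]; last by rewrite scale0r.
rewrite (_ : (U_(j) - U_(j))%MM = 0%MM) ?mpolyX0 ?scale1r //.
by apply/mnmP => k; rewrite mnmBE subnn mnm0E.
Qed.

Lemma mderiv_comp p F j :
  (p \mPo F)^`M(j) = \sum_(i < 3) (p^`M(i) \mPo F) * (tnth F i)^`M(j).
Proof.
elim/mpoly_ring_ind: p => [c|i|p q IHp IHq|p q IHp IHq].
- rewrite comp_mpolyC mderivC big1 // => i _; by rewrite mderivC comp_mpoly0 mul0r.
- rewrite comp_mpolyXU (bigD1 i) //= mderivXU eqxx rmorph1 mul1r -tnth_nth big1 ?addr0 //.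
  by move=> k nki; rewrite mderivXU eq_sym (negPf nki) comp_mpoly0 mul0r.
- rewrite comp_mpolyD mderivD IHp IHq -big_split; apply: eq_bigr => i _.
  by rewrite mderivD comp_mpolyD mulrDl.
- rewrite rmorphM mderivM IHp IHq mulr_suml mulr_sumr -big_split.
  apply: eq_bigr => i _.
  by rewrite mderivM comp_mpolyD !rmorphM /=; ring.
Qed.

Lemma form_pullback_comp F G om :
  form_pullback (comp_triple F G) om = form_pullback G (form_pullback F om).
Proof.
apply: eq_from_tnth => j; rewrite !tnth_mktuple.
under [RHS]eq_bigr do rewrite tnth_mktuple raddf_sum mulr_suml.
rewrite exchange_big; apply: eq_bigr => i _ /=.
rewrite tnth_mktuple mderiv_comp mulr_sumr; apply: eq_bigr => k _.
by rewrite rmorphM /= mulrA -comp_mpolyA.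
Qed.

Lemma form_pullback_scaled F om om' h :
  (forall i, tnth om' i = h * tnth om i) ->
  forall j, tnth (form_pullback F om') j = (h \mPo F) * tnth (form_pullback F om) j.
Proof.
move=> hom j; rewrite !tnth_mktuple mulr_sumr; apply: eq_bigr => i _.
by rewrite hom rmorphM /= mulrA.
Qed.

(** By the chain rule, d commutes with pull-back, so a relation D dN - N dD = k om pulls back term
    by term. This is how the first integral passes from one foliation to the other. *)
Lemma wronskian_comp (N D k : poly3) F om :
  (forall i, D * N^`M(i) - N * D^`M(i) = k * tnth om i) ->
  forall j, (D \mPo F) * (N \mPo F)^`M(j) - (N \mPo F) * (D \mPo F)^`M(j) =
    (k \mPo F) * tnth (form_pullback F om) j.
Proof.
move=> hW j; rewrite (mderiv_comp N) (mderiv_comp D) tnth_mktuple.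
rewrite 3!mulr_sumr -sumrB; apply: eq_bigr => i _.
have := congr1 (comp_mpoly F) (hW i).
by rewrite comp_mpolyB !rmorphM /= => E; rewrite [RHS]mulrA -E mulrBl !mulrA.
Qed.

Lemma form_pullback_id om : form_pullback (id_triple K) om = om.
Proof.
apply: eq_from_tnth => j; rewrite tnth_mktuple (bigD1 j) //= big1 => [|i nij].
  by rewrite tnth_mktuple mderivXU eqxx comp_mpoly_id mulr1 addr0.
by rewrite tnth_mktuple mderivXU (negPf nij) mulr0.
Qed.

(** Proportionality with an explicit factor composes easily, and it implies equality of kernels in
    [carries_maps]. Homogeneity of the factor is what [comp_neq0] requires to keep its pull-back
    nonzero. *)
Definition carries (F om om' : triple K) : Prop :=
  exists2 h : poly3, h != 0 /\ (exists d, h \is d.-homog) &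
    forall j, tnth (form_pullback F om') j = h * tnth om j.

Lemma carries_id om : carries (id_triple K) om om.
Proof.
exists 1; first by split; [exact: oner_neq0 | exists 0%N; exact: dhomog1].
by move=> j; rewrite form_pullback_id mul1r.
Qed.

Lemma carries_comp (A B : birmap K) om1 om2 om3 :
  carries (bir_map A) om1 om2 -> carries (bir_map B) om2 om3 ->
  carries (bir_map (bir_comp B A)) om1 om3.
Proof.
move=> [h [h0 [d hd]] hh] [k [k0 [e he]] hk].
exists ((k \mPo bir_map A) * h).
  split; first by rewrite mulf_neq0 // (comp_neq0 _ he).
  have [c hc] := bir_homog A.
  by exists (e * c + d)%N; apply: dhomogM hd; apply: comp_homog.
move=> j; rewrite form_pullback_comp.
by rewrite (form_pullback_scaled (bir_map A) hk) hh mulrA.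
Qed.

Lemma carries_iter (A : birmap K) (om : nat -> triple K) n :
  (forall k, carries (bir_map A) (om k) (om k.+1)) ->
  carries (bir_map (iter n (bir_comp A) (bir_id K))) (om 0%N) (om n).
Proof.
move=> hA; elim: n => [|n IH]; first exact: carries_id.
exact: carries_comp IH (hA n).
Qed.

(** Pencil members agree with the forms of the foliations only up to constants; this adjusts both
    ends. *)
Lemma carries_scale F om1 om2 om1' om2' (c d : K) :
  c != 0 -> d != 0 ->
  (forall i, tnth om1 i = c%:MP * tnth om1' i) ->
  (forall i, tnth om2' i = d%:MP * tnth om2 i) ->
  carries F om1 om2 -> carries F om1' om2'.
Proof.
move=> c0 d0 h1 h2 [h [h0 [e he]] hh]; exists ((d * c)%:MP * h).
  by split; [rewrite mulf_neq0 ?mpolyC_eq0 ?mulf_neq0 | exists e; apply: homogCM].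
move=> j; rewrite (form_pullback_scaled _ h2) hh h1 comp_mpolyC mpolyCM.
by ring.
Qed.

Lemma carries_maps (A : birmap K) (F G : foliation K) :
  carries (bir_map A) (fol_form F) (fol_form G) -> maps_foliation A F G.
Proof.
move=> [h [h0 _] hh] v.
have -> : contract (form_pullback (bir_map A) (fol_form G)) v = h * contract (fol_form F) v.
  by rewrite /contract mulr_sumr; apply: eq_bigr => i _; rewrite hh mulrA.
by split=> [->|/eqP]; rewrite ?mulr0 // mulf_eq0 (negPf h0) => /eqP.
Qed.

End Pullback.

(** * The pencil of forms and the action of B_4 and S_4 on it *)

Section Pencil.
Set Implicit Arguments.
Unset Strict Implicit.
Variable K : fieldType.
Local Notation poly3 := {mpoly K[3]}.
Local Notation x := ('X_(0 : 'I_3) : poly3).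
Local Notation y := ('X_(1 : 'I_3) : poly3).
Local Notation z := ('X_(2%:R : 'I_3) : poly3).

(** Keeping w as a parameter covers the inverse maps too, through w^2. For b nonzero this is b times
    the form of F^4_alpha with alpha = 1 - (1 + 2 w) a / b. *)
Definition pencil (w a b : K) : triple K :=
  let c := (1 + 2%:R * w)%:MP * a%:MP in
  [tuple (y ^+ 3 - z ^+ 3) * (b%:MP * (y * z - x ^+ 2) + c * x ^+ 2);
         (z ^+ 3 - x ^+ 3) * (b%:MP * (x * z - y ^+ 2) + c * y ^+ 2);
         (x ^+ 3 - y ^+ 3) * (b%:MP * (x * y - z ^+ 2) + c * z ^+ 2)].

Variable w : K.
Hypothesis hw : w ^+ 2 + w + 1 = 0.

(* Replacing w by w^2 turns the maps into their inverses, so this equation transfers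
   the formulas for S4 and U4 to the inverse maps. *)
Lemma pencil_conj a b : pencil (w ^+ 2) a b = pencil w (- a) b.
Proof.
rewrite /pencil mpolyCN; suff -> : (1 + 2%:R * w ^+ 2)%:MP = - (1 + 2%:R * w)%:MP :> poly3.
  by rewrite mulrN mulNr.
rewrite -mpolyCN; congr (_%:MP).
have hw2 : w ^+ 2 = - w - 1 by apply/eqP; rewrite -subr_eq0 -hw; apply/eqP; ring.
by ring: hw2.
Qed.

Let W : poly3 := w%:MP.
Let hW : W ^+ 2 = - W - 1.
Proof.
rewrite /W -rmorphXn /= -mpolyC1 -mpolyCN -mpolyCB; congr (_%:MP).
by apply/eqP; rewrite -subr_eq0 -hw; apply/eqP; ring.
Qed.

Definition mderivE :=
  (@mderivD 3 K, @mderivB 3 K, @mderivM 3 K, @mderivC 3 K, @mderivXU K, @mderivN 3 K).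

Let mpC2 : (1 + 2%:R * w)%:MP = 1 + 2%:R * W.
Proof. by rewrite mpolyCD mpolyCM mpolyC_nat. Qed.

(** Written through the components u_i, so that for U_4 the differences of cubes can be factored
    before anything is expanded. *)
Lemma pencil_pullback a b (F : triple K) j :
  let u1 := tnth F 0 in let u2 := tnth F 1 in let u3 := tnth F 2%:R in
  tnth (form_pullback F (pencil w a b)) j =
  (u2 ^+ 3 - u3 ^+ 3) * (b%:MP * (u2 * u3 - u1 ^+ 2) + (1 + 2%:R * W) * a%:MP * u1 ^+ 2)
    * u1^`M(j)
  + (u3 ^+ 3 - u1 ^+ 3) * (b%:MP * (u1 * u3 - u2 ^+ 2) + (1 + 2%:R * W) * a%:MP * u2 ^+ 2)
    * u2^`M(j)
  + (u1 ^+ 3 - u2 ^+ 3) * (b%:MP * (u1 * u2 - u3 ^+ 2) + (1 + 2%:R * W) * a%:MP * u3 ^+ 2)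
    * u3^`M(j).
Proof.
move=> u1 u2 u3; rewrite tnth_mktuple sum3 -/u1 -/u2 -/u3.
have E i : 'X_i \mPo F = tnth F i by rewrite comp_mpolyXU -tnth_nth.
rewrite /pencil mpC2 ![tnth [tuple _; _; _] _](tnth_nth 0) /=
  !(rmorphB, rmorphD, rmorphXn, rmorphM) /= !comp_mpolyC !E ?rmorph1 ?rmorphMn /= ?rmorph1.
by [].
Qed.

Let P : triple K :=
  [tuple (y ^+ 3 - z ^+ 3) * (y * z); (z ^+ 3 - x ^+ 3) * (x * z); (x ^+ 3 - y ^+ 3) * (x * y)].
Let Q : triple K :=
  [tuple (y ^+ 3 - z ^+ 3) * x ^+ 2; (z ^+ 3 - x ^+ 3) * y ^+ 2; (x ^+ 3 - y ^+ 3) * z ^+ 2].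

Let pencilE a b j : tnth (pencil w a b) j =
  b%:MP * (tnth P j - tnth Q j) + (1 + 2%:R * W) * a%:MP * tnth Q j.
Proof. by elim/ord3_ind: j; rewrite !(tnth_nth 0) /= mpC2; ring. Qed.

Lemma B4_pencil a b j :
  tnth (form_pullback (B4_triple w) (pencil w b (- a))) j = 27%:R * tnth (pencil w a b) j.
Proof.
rewrite pencil_pullback pencilE !(tnth_nth 0) /= !mderivE mpolyCN rmorphXn /= -/W.
elim/ord3_ind: j => /=.
by ring: hW.
by ring: hW.
by ring: hW.
Qed.

(** The squared cubic is the common factor found in [S4_retracts]; 2 w^2 times it is the Jacobian
    determinant of S_4. *)
Lemma S4_pencil a b j :
  tnth (form_pullback (S4_triple w) (pencil w a (- w * b))) j =
  - (x ^+ 3 + y ^+ 3 + z ^+ 3 - 3%:R * W * x * y * z) ^+ 2 * tnth (pencil w a b) j.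
Proof.
rewrite pencil_pullback pencilE !(tnth_nth 0) /= !expr2 !mderivE mpolyCM mpolyCN -/W.
elim/ord3_ind: j => /=.
by ring: hW.
by ring: hW.
by ring: hW.
Qed.

(** * The action of U_4 on the pencil *)

Local Notation l1 := (W ^+ 2 * x + y + z).
Local Notation l2 := (x + W ^+ 2 * y + z).
Local Notation l3 := (x + y + W ^+ 2 * z).
Local Notation q1 := (x * y + x * z + W * y * z).
Local Notation q2 := (W * x * z + x * y + y * z).
Local Notation q3 := (x * z + y * z + W * x * y).
Local Notation k1 := (x ^+ 2 - W ^+ 2 * y * z).
Local Notation k2 := (y ^+ 2 - W ^+ 2 * x * z).
Local Notation k3 := (z ^+ 2 - W ^+ 2 * x * y).
Local Notation B1 := ((y - z) * (x - W * y) * (x - W * z)).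
Local Notation B2 := ((z - x) * (y - W * z) * (y - W * x)).
Local Notation B3 := ((x - y) * (z - W * x) * (z - W * y)).

(* U4 has components L q_i / l_i, where L = l1 l2 l3. The form l_i dq_i - q_i dl_i
   comes from d(q_i / l_i); the terms in dL cancel in U4_pencil. *)
Let U4_term (r1 r2 r3 s1 s2 s3 dr1 dr2 dr3 ds1 B b c : poly3) :
  let L := r1 * r2 * r3 in
  let dL := dr1 * r2 * r3 + r1 * dr2 * r3 + r1 * r2 * dr3 in
  let e1 := r1 * ds1 - s1 * dr1 in
  B * r1 ^+ 3 * (b * (s2 * s3 * r1 ^+ 2 * r2 * r3 - s1 ^+ 2 * r2 ^+ 2 * r3 ^+ 2)
                 + c * (s1 ^+ 2 * r2 ^+ 2 * r3 ^+ 2))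
    * (ds1 * r2 * r3 + s1 * (dr2 * r3 + r2 * dr3)) =
  L ^+ 2 * (b * (B * r1 ^+ 2 * s2 * s3 * e1 - B * s1 ^+ 2 * r2 * r3 * e1)
            + c * (B * s1 ^+ 2 * r2 * r3 * e1))
  + dL * (b * L * s1 * s2 * s3 * (B * r1 ^+ 3) + (c - b) * L ^+ 2 * (B * s1 ^+ 3)).
Proof. by cbv zeta; ring. Qed.

(** What remains of the pull-back of P once the terms in dL, the powers of L and the common factor
    of the cubes are split off: degree 11 instead of 23. [U4_Q] is the analogue for Q. *)
Let U4_P j :
  B1 * l1 ^+ 2 * q2 * q3 * (l1 * q1^`M(j) - q1 * l1^`M(j))
  + B2 * l2 ^+ 2 * q3 * q1 * (l2 * q2^`M(j) - q2 * l2^`M(j))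
  + B3 * l3 ^+ 2 * q1 * q2 * (l3 * q3^`M(j) - q3 * l3^`M(j))
  = - 3%:R * (k1 * k2 * k3) * (2%:R * tnth P j + W * tnth Q j).
Proof.
rewrite !expr2 !mderivE; elim/ord3_ind: j; rewrite !(tnth_nth 0) /=.
- by ring: hW.
- by ring: hW.
- by ring: hW.
Qed.

Let U4_Q j :
  B1 * q1 ^+ 2 * l2 * l3 * (l1 * q1^`M(j) - q1 * l1^`M(j))
  + B2 * q2 ^+ 2 * l3 * l1 * (l2 * q2^`M(j) - q2 * l2^`M(j))
  + B3 * q3 ^+ 2 * l1 * l2 * (l3 * q3^`M(j) - q3 * l3^`M(j))
  = 3%:R * (k1 * k2 * k3) * (W * tnth P j + 2%:R * W ^+ 2 * tnth Q j).
Proof.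
rewrite !expr2 !mderivE; elim/ord3_ind: j; rewrite !(tnth_nth 0) /=.
- by ring: hW.
- by ring: hW.
- by ring: hW.
Qed.

Lemma U4_pencil a b j :
  tnth (form_pullback (U4_triple w) (pencil w a (b - a))) j =
  - 27%:R * (l1 * l2 * l3) ^+ 2 * (k1 * k2 * k3) ^+ 2 * tnth (pencil w a b) j.
Proof.
pose u1 := q1 * l3 * l2; pose u2 := q2 * l1 * l3; pose u3 := q3 * l2 * l1.
have U0 : tnth (U4_triple w) 0 = u1 by rewrite (tnth_nth 0) /= rmorphXn.
have U1 : tnth (U4_triple w) 1 = u2 by rewrite (tnth_nth 0) /= rmorphXn.
have U2 : tnth (U4_triple w) 2%:R = u3 by rewrite (tnth_nth 0) /= rmorphXn.
pose cb := (b - a)%:MP : poly3; pose ca := (1 + 2%:R * W) * a%:MP : poly3.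
have -> : tnth (form_pullback (U4_triple w) (pencil w a (b - a))) j =
  (u2 ^+ 3 - u3 ^+ 3) * (cb * (u2 * u3 - u1 ^+ 2) + ca * u1 ^+ 2) * u1^`M(j)
  + (u3 ^+ 3 - u1 ^+ 3) * (cb * (u1 * u3 - u2 ^+ 2) + ca * u2 ^+ 2) * u2^`M(j)
  + (u1 ^+ 3 - u2 ^+ 3) * (cb * (u1 * u2 - u3 ^+ 2) + ca * u3 ^+ 2) * u3^`M(j).
  by rewrite pencil_pullback U0 U1 U2.
(* Each difference of cubes splits off the same k1 k2 k3, leaving l_i^3 and three linear factors. *)
have e1 : u2 ^+ 3 - u3 ^+ 3 = 3%:R * (1 - W) * (k1 * k2 * k3) * (B1 * l1 ^+ 3).
  by rewrite /u2 /u3; ring: hW.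
have e2 : u3 ^+ 3 - u1 ^+ 3 = 3%:R * (1 - W) * (k1 * k2 * k3) * (B2 * l2 ^+ 3).
  by rewrite /u1 /u3; ring: hW.
have e3 : u1 ^+ 3 - u2 ^+ 3 = 3%:R * (1 - W) * (k1 * k2 * k3) * (B3 * l3 ^+ 3).
  by rewrite /u2 /u1; ring: hW.
(* These two relations make the coefficients of dL vanish. *)
have f1 : B1 * l1 ^+ 3 + B2 * l2 ^+ 3 + B3 * l3 ^+ 3 = 0 by ring: hW.
have f2 : B1 * q1 ^+ 3 + B2 * q2 ^+ 3 + B3 * q3 ^+ 3 = 0 by ring: hW.
have gP := U4_P j; have gQ := U4_Q j.
rewrite e1 e2 e3 pencilE /u1 /u2 /u3 !mderivM.
have hc : b%:MP = cb + a%:MP by rewrite /cb mpolyCB subrK.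
rewrite hc; clear hc e1 e2 e3; clearbody cb.
move: (tnth P j) (tnth Q j) gP gQ f1 f2 => Pj Qj.
(* The polynomials and their derivatives become unknowns tied only by [gP], [gQ], [f1] and [f2], so
   that [ring] does not expand them. *)
move: (k1 * k2 * k3) => k.
move: (l1^`M(j)) (l2^`M(j)) (l3^`M(j)) (q1^`M(j)) (q2^`M(j)) (q3^`M(j)).
move: l1 l2 l3 q1 q2 q3 B1 B2 B3.
move=> r1 r2 r3 s1 s2 s3 C1 C2 C3 dr1 dr2 dr3 ds1 ds2 ds3 gP gQ f1 f2.
have t1 := U4_term r1 r2 r3 s1 s2 s3 dr1 dr2 dr3 ds1 C1 cb ca.
have t2 := U4_term r2 r3 r1 s2 s3 s1 dr2 dr3 dr1 ds2 C2 cb ca.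
have t3 := U4_term r3 r1 r2 s3 s1 s2 dr3 dr1 dr2 ds3 C3 cb ca.
pose L := r1 * r2 * r3.
pose dL := dr1 * r2 * r3 + r1 * dr2 * r3 + r1 * r2 * dr3.
(* The two factors 0 are placeholders: rewriting backwards turns them into the sums of [f1] and
   [f2], while [gP] and [gQ] restore the sums produced by [t1], [t2] and [t3]. *)
transitivity (3%:R * (1 - W) * k * (L ^+ 2 * (cb * (- 3%:R * k * (2%:R * Pj + W * Qj)
      - 3%:R * k * (W * Pj + 2%:R * W ^+ 2 * Qj))
      + ca * (3%:R * k * (W * Pj + 2%:R * W ^+ 2 * Qj)))
    + dL * (cb * L * s1 * s2 * s3 * 0 + (ca - cb) * L ^+ 2 * 0))); last first.
  by rewrite /ca /L; ring: hW.
rewrite -{1}f1 -f2 -gP -gQ.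
transitivity (3%:R * (1 - W) * k * (
  (C1 * r1 ^+ 3 * (cb * (s2 * s3 * r1 ^+ 2 * r2 * r3 - s1 ^+ 2 * r2 ^+ 2 * r3 ^+ 2)
                 + ca * (s1 ^+ 2 * r2 ^+ 2 * r3 ^+ 2))
    * (ds1 * r2 * r3 + s1 * (dr2 * r3 + r2 * dr3)))
  + (C2 * r2 ^+ 3 * (cb * (s3 * s1 * r2 ^+ 2 * r3 * r1 - s2 ^+ 2 * r3 ^+ 2 * r1 ^+ 2)
                 + ca * (s2 ^+ 2 * r3 ^+ 2 * r1 ^+ 2))
    * (ds2 * r3 * r1 + s2 * (dr3 * r1 + r3 * dr1)))
  + (C3 * r3 ^+ 3 * (cb * (s1 * s2 * r3 ^+ 2 * r1 * r2 - s3 ^+ 2 * r1 ^+ 2 * r2 ^+ 2)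
                 + ca * (s3 ^+ 2 * r1 ^+ 2 * r2 ^+ 2))
    * (ds3 * r1 * r2 + s3 * (dr1 * r2 + r1 * dr2))))).
  by clear; ring.
rewrite t1 t2 t3 /L /dL; clear; ring.
Qed.

Hypotheses (h2 : 2%:R != 0 :> K) (h3 : 3%:R != 0 :> K).

Let w0 : w != 0.
Proof.
by apply: contra_eq_neq hw => ->; rewrite expr0n /= !add0r oner_neq0.
Qed.

Lemma B4_carries a b : carries (B4_triple w) (pencil w a b) (pencil w b (- a)).
Proof.
exists 27%:R; last exact: B4_pencil.
split; last by exists 0%N; rewrite -mpolyC_nat -[_%:MP]mulr1; apply/homogCM/dhomog1.
rewrite -mpolyC_nat mpolyC_eq0 (_ : 27%:R = 3%:R * (3%:R * 3%:R) :> K); last by ring.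
by rewrite !mulf_neq0.
Qed.

Lemma S4_carries a b : carries (S4_triple w) (pencil w a b) (pencil w a (- w * b)).
Proof.
eexists; last exact: S4_pencil.
split.
  rewrite oppr_eq0 expf_neq0 //; apply: (@mpoly_neq0 _ _ (fun i => (i == 0)%:R)).
  rewrite /W !(mevalD, mevalN, mevalM, rmorphXn, mevalC, mevalXU) /=.
  set t := (X in X != 0); have -> : t = 1 by rewrite /t; ring.
  exact: oner_neq0.
have hX (i : 'I_3) : ('X_i ^+ 3 : poly3) \is 3.-homog.
  by have := dhomogMn 3 (homogX K i); rewrite mul1n.
exists (3 * 2)%N; rewrite rpredN; apply: dhomogMn; apply: rpredB; first by rewrite !rpredD ?hX.
rewrite -!mulrA /W -mpolyC_nat; apply/homogCM/homogCM.
by apply: (@homogM _ _ _ 1 2); rewrite ?homogX //; apply: (@homogM _ _ _ 1 1); rewrite ?homogX.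
Qed.

Lemma U4_carries a b : carries (U4_triple w) (pencil w a b) (pencil w a (b - a)).
Proof.
eexists; last exact: U4_pencil.
have hl : (l1 \is 1.-homog) /\ (l2 \is 1.-homog) /\ (l3 \is 1.-homog).
  by rewrite /W -rmorphXn /= !rpredD ?homogX ?homogCX.
have hX2 (i : 'I_3) : ('X_i ^+ 2 : poly3) \is 2.-homog.
  by have := dhomogMn 2 (homogX K i); rewrite mul1n.
have hXX (i m : 'I_3) : (W ^+ 2 * 'X_i * 'X_m : poly3) \is 2.-homog.
  by rewrite /W -rmorphXn /= -mulrA; apply/homogCM/(@homogM _ _ _ 1 1); rewrite ?homogX.
split.
  (* At (1, 1, 0) the factor equals -108 w^2, which is nonzero by [h2], [h3] and [w0]. *)
  apply: (@mpoly_neq0 _ _ (fun i => (i != 2%:R)%:R)).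
  rewrite /W !(mevalD, mevalM, mevalN, rmorphXn, mevalC, mevalXU) /=.
  set t := (X in X != 0).
  have -> : t = - (2%:R * (2%:R * (3%:R * (3%:R * 3%:R)))) * (w * w).
    have hw2 : w ^+ 2 = - w - 1 by apply/eqP; rewrite -subr_eq0 -hw; apply/eqP; ring.
    by rewrite /t; ring: hw2.
  by rewrite mulf_neq0 ?oppr_eq0 ?mulf_neq0.
exists ((1 + 1 + 1) * 2 + (2 + 2 + 2) * 2)%N.
have [? [? ?]] := hl.
rewrite !mulNr rpredN -mulrA -mpolyC_nat; apply/homogCM.
apply: dhomogM; apply: dhomogMn; do 2?apply: dhomogM => //.
- by rewrite rpredB ?hX2 ?hXX.
- by rewrite rpredB ?hX2 ?hXX.
- by rewrite rpredB ?hX2 ?hXX.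
Qed.
End Pencil.

(** * Differentiation along leaf arcs and constancy on a disc *)

Section Analysis.
Local Open Scope classical_set_scope.
Set Implicit Arguments.
Unset Strict Implicit.
Variable R : realType.
Local Notation C := (R[i]).

Lemma is_derive_meval (p : {mpoly C[3]}) (g : C -> 'I_3 -> C) (t : C^o) :
  (forall i, derivable (fun s : C^o => g s i : C^o) t 1) ->
  is_derive t 1 (fun s : C^o => p.@[g s] : C^o)
    (\sum_(i < 3) (p^`M(i)).@[g t] * 'D_1 (fun s : C^o => g s i : C^o) t).
Proof.
move=> dg; elim/mpoly_ring_ind: p => [c|i|p q IHp IHq|p q IHp IHq].
- rewrite big1 => [|i _]; last by rewrite mderivC meval0 mul0r.
  by under eq_fun do rewrite mevalC; exact: is_derive_cst.
- rewrite (bigD1 i) //= mderivXU eqxx meval1 mul1r big1 ?addr0 => [|k nki].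
    by under eq_fun do rewrite mevalXU; exact: derivableP.
  by rewrite mderivXU eq_sym (negPf nki) meval0 mul0r.
- under eq_fun do rewrite mevalD.
  apply: is_derive_eq; rewrite -big_split; apply: eq_bigr => i _.
  by rewrite mderivD mevalD mulrDl.
- under eq_fun do rewrite mevalM.
  apply: is_derive_eq; rewrite /GRing.scale /= !mulr_sumr -big_split.
  apply: eq_bigr => i _ /=; rewrite mderivM mevalD !mevalM mulrDl addrC.
  by congr (_ + _); rewrite mulrA // [_ * _^`M(i).@[_]]mulrC.
Qed.

(** The differential is [K]-linear, so its vanishing at 1 forces its vanishing in every direction
    d. *)
Lemma derive0_cvg (K : numFieldType) (f : K^o -> K^o) (z d : K^o) : is_derive z 1 f 0 ->
  (fun h : K^o => h^-1 *: (f (h *: d + z) - f z)) @ 0^' --> (0 : K^o).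
Proof.
move=> [df f0].
have dd : differentiable f z by apply/derivable1_diffP.
have E : 'D_d f z = 0.
  rewrite deriveE //.
  have -> : 'd f z d = d *: 'd f z 1 by rewrite -linearZ /= [_ *: 1]mulr1.
  by rewrite -deriveE // f0 scaler0.
have /cvg_ex [l hl] : derivable f z d by exact: diff_derivable.
have L : l = 0 by rewrite -E; apply/esym; exact: cvg_lim hl.
by rewrite L in hl.
Qed.

Lemma is_derive_quotient (K : numFieldType) (f g : K^o -> K^o) (x v df dg : K^o) :
  g x != 0 -> is_derive x v f df -> is_derive x v g dg ->
  is_derive x v (fun y => f y / g y : K^o) ((g x * df - f x * dg) / g x ^+ 2).
Proof.
move=> gx0 hf hg.
have hgV : is_derive x v (fun y => (g y)^-1 : K^o) (- (g x) ^- 2 *: dg).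
  case: hg => Dg <-.
  by apply: DeriveDef; [exact: derivableV | exact: deriveV].
have hm := is_deriveM hf hgV.
by apply: is_derive_eq; rewrite /GRing.scale /=; field.
Qed.

(** For real increments the real difference quotient is the real part of the complex one, and |Re z|
    <= |z| transfers the limit. *)
Lemma Re_line_derive0 (f : C^o -> C^o) (d z0 : C^o) (u : R) :
  is_derive (z0 + u%:C *: d) 1 f 0 ->
  is_derive u 1 (fun v : R => complex.Re (f (z0 + v%:C *: d) : C) : R) 0.
Proof.
set z : C^o := z0 + u%:C *: d => dfz.
have H := @derive0_cvg _ f z d dfz.
have K : (fun h : R => h^-1 *: (complex.Re (f (z0 + (h *: 1 + u)%:C *: d) : C) - complex.Re (f z : C) : R)) @ 0^' --> (0 : R).
  apply/cvgrPdist_lt => e e0.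
  have e0' : 0 < e%:C by rewrite ltcR.
  move/cvgrPdist_lt : H => /(_ _ e0').
  (* Positivity in the order of the complex numbers forces the radius to be real. *)
  case/nbhs_ballP => -[del i0] /=; rewrite ltcE /= => /andP[/eqP -> del0] Hd.
  apply/nbhs_ballP; exists del => //= h; rewrite -ball_normE /= sub0r normrN => hdel h0.
  have hC : ball (0 : C^o) (del%:C) (h%:C : C^o).
    by rewrite -ball_normE /= sub0r normrN normc_def /= expr0n addr0 sqrtr_sqr ltcR.
  have hC0 : h%:C != 0 :> C by rewrite (inj_eq (@complexI R)).
  have := Hd _ hC hC0.
  have -> : h%:C *: d + z = z0 + (h *: 1 + u)%:C *: d.
    by rewrite /z [h *: 1]mulr1 rmorphD scalerDl addrCA.
  set D := _ - f z; rewrite !sub0r !normrN -ltcR; apply: le_lt_trans.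
  apply: le_trans (normc_ge_Re _); rewrite lecR /=.
  rewrite [X in _ <= `|X|](_ : _ = h^-1 * complex.Re D); last first.
    have hV : (h%:C : C)^-1 = (h^-1)%:C by rewrite fmorphV.
    rewrite -[LHS]/(complex.Re ((h%:C : C)^-1 * (D : C))) hV.
    by case: (D) => a b /=; rewrite mul0r subr0.
  rewrite (_ : complex.Re D = complex.Re (f (z0 + (h *: 1 + u)%:C *: d) : C) - complex.Re (f z : C)) //.
  by rewrite /D; case: (f _) (f z) => [? ?] [? ?].
apply: DeriveDef.
  apply/cvg_ex; exists 0; exact: K.
exact: cvg_lim K.
Qed.

Lemma disc_convex (c s t : C) (e u : R) :
  `|s - c| < e%:C -> `|t - c| < e%:C -> 0 <= u <= 1 ->
  `|s + u%:C * (t - s) - c| < e%:C.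
Proof.
move=> hs ht /andP[u0 u1].
have -> : s + u%:C * (t - s) - c = (1 - u%:C) * (s - c) + u%:C * (t - c) by ring.
apply: le_lt_trans (ler_normD _ _) _; rewrite !normrM.
have u0C : 0 <= u%:C by rewrite lecR.
have u1C : 0 <= 1 - u%:C by rewrite subr_ge0 lecR.
rewrite (ger0_norm u0C) (ger0_norm u1C) -subr_gt0.
have -> : e%:C - ((1 - u%:C) * `|s - c| + u%:C * `|t - c|) =
  (1 - u%:C) * (e%:C - `|s - c|) + u%:C * (e%:C - `|t - c|) by ring.
(* The second summand is strictly positive only for u nonzero; at u = 0 the first one is. *)
have [->|un0] := eqVneq u 0.
  by rewrite mul0r addr0 subr0 mul1r subr_gt0.
apply: ltr_wpDl; first by rewrite mulr_ge0 // subr_ge0 ltW.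
by rewrite mulr_gt0 ?subr_gt0 // ltcR lt_neqAle eq_sym un0.
Qed.

(** The mean value theorem is real, so it is applied to real parts along the segment from s to t,
    which stays in the disc. *)
Lemma derive0_cst_on_disc (f : C^o -> C^o) (c : C) (e : R) :
  (forall t : C, `|t - c| < e%:C -> is_derive (t : C^o) 1 f 0) ->
  forall s t : C, `|s - c| < e%:C -> `|t - c| < e%:C -> f s = f t.
Proof.
move=> df s t hs ht.
(* Multiplying by an arbitrary k recovers both coordinates of f from real parts. *)
have cst (k : C^o) : complex.Re (k * f s : C) = complex.Re (k * f t : C).
  pose phi (v : R) := complex.Re (k *: f ((s : C^o) + v%:C *: (t - s : C^o)) : C).
  have dphi (v : R) : 0 <= v <= 1 -> is_derive v 1 phi 0.
    move=> v01; apply: (@Re_line_derive0 (fun x => k *: f x)).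
    have dv := df _ (disc_convex hs ht v01).
    by apply: is_derive_eq; rewrite scaler0.
  have [v||v _] := @MVT_segment R phi (fun=> 0) 0 1 ler01.
  - by rewrite in_itv /= => /andP[/ltW v0 /ltW v1]; apply: dphi; rewrite v0.
  - apply: derivable_within_continuous => v; rewrite in_itv /= => v01.
    by have [] := dphi _ v01.
  rewrite mul0r => /eqP; rewrite subr_eq0 => /eqP.
  by rewrite /phi scale0r addr0 scale1r addrC subrK => ->.
have := cst 1; rewrite !mul1r; have := cst (- 'i)%C; rewrite !mulNr.
case: (f s) (f t) => [a b] [a' b'] /=.
by rewrite !mul0r !mul1r !sub0r !opprK => -> ->.
Qed.

(** By the quotient rule, the derivative of [H] along an arc has as numerator k times the form
    evaluated on the velocity, which vanishes on a leaf. *)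
Lemma constant_on_leaves_wronskian (F : foliation C) (H : ratfun C) (k : {mpoly C[3]}) :
  (forall i, rf_den H * (rf_num H)^`M(i) - rf_num H * (rf_den H)^`M(i) =
     k * tnth (fol_form F) i) ->
  constant_on_leaves F H.
Proof.
move=> hW c e g hg hden.
apply: (@derive0_cst_on_disc (fun s => (rf_num H).@[g s] / (rf_den H).@[g s])).
move=> t ht; have [dg _ g0] := hg t ht; have D0 := hden t ht.
have dN := is_derive_meval (rf_num H) dg.
have dD := is_derive_meval (rf_den H) dg.
apply: (is_derive_eq (is_derive_quotient D0 dN dD)).
set E := _ - _; suff -> : E = 0 by rewrite mul0r.
transitivity (k.@[g t] * 0); last by rewrite mulr0.
rewrite /E -[in RHS]g0 !mulr_sumr -sumrB.
apply: eq_bigr => i _; rewrite !mulrA -mulrBl -[in RHS]mevalM -hW.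
by rewrite mevalB mevalM mevalM.
Qed.
End Analysis.

(** * The maps W_q and the run of the algorithm *)

Section Eisenstein.
Set Implicit Arguments.
Unset Strict Implicit.
Variable R : realType.
Local Notation C := (R[i]).
Local Notation w := (omega R).
Local Notation val := (eis_val R).

Let w3 : w ^+ 2 = - w - 1.
Proof. by apply/eqP; rewrite -subr_eq0 -(omegaE R); apply/eqP; ring. Qed.

Let w3' : (w ^+ 2) ^+ 2 + w ^+ 2 + 1 = 0.
Proof. by ring: w3. Qed.

Let n2 : 2%:R != 0 :> C. Proof. by rewrite pnatr_eq0. Qed.
Let n3 : 3%:R != 0 :> C. Proof. by rewrite pnatr_eq0. Qed.

(** The inverse is S_4 with w^2 for w; the sign that [pencil_conj] puts on the first parameter is
    undone by starting from -a. *)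
Lemma S4_inv_carries (a b : C) :
  carries (bir_map (bir_inv (S4 R))) (pencil w a b) (pencil w a (- w ^+ 2 * b)).
Proof.
have := S4_carries w3' (- a) b.
by rewrite !(pencil_conj (omegaE R)) opprK.
Qed.

Lemma U4_inv_carries (a b : C) :
  carries (bir_map (bir_inv (U4 R))) (pencil w a b) (pencil w a (b + a)).
Proof.
have := U4_carries w3' n2 n3 (- a) b.
by rewrite !(pencil_conj (omegaE R)) !opprK.
Qed.

Lemma U4_expz_carries (n : int) (a b : C) :
  carries (bir_map (bir_expz (U4 R) n)) (pencil w a b) (pencil w a (b - n%:~R * a)).
Proof.
case: n => n /=.
  have := @carries_iter _ (U4 R) (fun k => pencil w a (b - k%:R * a)) n.
  rewrite mul0r subr0; apply => k.
  rewrite (_ : b - k.+1%:R * a = b - k%:R * a - a); last by rewrite -natr1; ring.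
  exact: U4_carries (omegaE R) n2 n3 _ _.
have := @carries_iter _ (bir_inv (U4 R)) (fun k => pencil w a (b + k%:R * a)) n.+1.
rewrite mul0r addr0 NegzE mulrNz mulNr opprK; apply => k.
rewrite (_ : b + k.+1%:R * a = b + k%:R * a + a); last by rewrite -natr1; ring.
exact: U4_inv_carries.
Qed.

(** For q = m + n w the successive pairs are (b, -a), (b, c) with c = m b - a, (b, -w^2 c), (b, -w^2
    c - n b) and finally (b, c + n w b), since w^3 = 1. *)
Lemma W4_carries (q : eisenstein) (a b : C) :
  carries (bir_map (W4 R q)) (pencil w a b) (pencil w b (val q * b - a)).
Proof.
have hB : carries (bir_map (B4 R)) (pencil w a b) (pencil w b (- a)).
  exact: B4_carries (omegaE R) n3 a b.
have hS (c d : C) : carries (bir_map (S4 R)) (pencil w c d) (pencil w c (- w * d)).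
  exact: S4_carries (omegaE R) c d.
rewrite (_ : val q * b - a = - w * (- w ^+ 2 * (- a - (- q.1)%:~R * b) - q.2%:~R * b)).
  exact: (carries_comp (carries_comp (carries_comp (carries_comp hB
    (U4_expz_carries (- q.1) _ _)) (S4_inv_carries _ _)) (U4_expz_carries q.2 _ _))
    (hS _ _)).
by rewrite /eis_val mulrNz; ring: w3.
Qed.

(** W_q with q = q_{k+1} sends (r_{k-1}, r_k) to (r_k, q_{k+1} r_k - r_{k-1}), which is (r_k,
    r_{k+1}) by the division step. *)
Lemma W4_comp_carries (a b : eisenstein) M q r : euclid_run R a b M q r ->
  forall k, (k <= M)%N ->
  carries (bir_map (W4_comp R q k)) (pencil w (val a) (val b))
    (pencil w (val (r (k%:Z - 1))) (val (r k%:Z))).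
Proof.
move=> [ra rb hr _]; elim=> [_|k IH kM].
  by rewrite sub0r ra rb; exact: carries_id.
have := carries_comp (IH (ltnW kM)) (W4_carries (q k.+1) _ _).
rewrite -[bir_comp _ _]/(W4_comp R q k.+1).
have k1 : k.+1%:Z - 1 = k%:Z by rewrite -addn1 PoszD addrK.
have k2 : k.+1%:Z - 2 = k%:Z - 1 by rewrite -addn1 PoszD; ring.
have [|E _] := hr k.+1; first by rewrite kM.
by move: E; rewrite k1 k2 => ->; rewrite opprB addrC subrK.
Qed.

Lemma eis_norm_val (q : eisenstein) :
  (eis_norm q)%:~R = val q * (q.1%:~R + q.2%:~R * w ^+ 2) :> C.
Proof.
rewrite /eis_norm /eis_val !(rmorphD, rmorphB, rmorphXn, rmorphM) /=.
by ring: w3.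
Qed.

Lemma eis_val0 (q : eisenstein) : val q = 0 -> eis_norm q = 0.
Proof.
move=> q0; apply/eqP; rewrite -(intr_eq0 C) eis_norm_val q0 mul0r //.
Qed.

(** This keeps the final pencil member from being the zero form: r_M has norm 0, and the norm of
    r_{M-1} is strictly larger. *)
Lemma euclid_run_last (a b : eisenstein) M q r :
  val b != 0 -> euclid_run R a b M q r ->
  (0 < M)%N /\ val (r (M%:Z - 1)) != 0.
Proof.
move=> b0 [_ rb hr hM].
have M0 : (0 < M)%N by case: M hM {hr} => // hM; move: b0; rewrite -rb hM eqxx.
split=> //; have [|_] := hr M; first by rewrite M0 leqnn.
by rewrite (eis_val0 hM) => lt0; apply: contraTneq lt0 => /eis_val0 ->; rewrite ltxx.
Qed.

(** * The two foliations in the pencil and the first integral *)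

Lemma F4_pencil (a b alpha : C) : b != 0 ->
  3^-1 * (1 + 2 * w) * (1 - alpha) = - (a / b) ->
  forall i, tnth (pencil w a b) i = b%:MP * tnth (F4_form alpha) i.
Proof.
move=> b0 hab i.
have hc : (1 + 2 * w)%:MP * a%:MP = b%:MP * (1 - alpha%:MP) :> {mpoly C[3]}.
  rewrite -mpolyC1 -mpolyCB -!mpolyCM; congr (_%:MP).
  have -> : a = - (3^-1 * (1 + 2 * w) * (1 - alpha)) * b by rewrite hab opprK divfK.
  by field: w3.
by elim/ord3_ind: i; rewrite !(tnth_nth 0) /= hc; ring.
Qed.

Lemma F4oo_pencil (a : C) i :
  tnth (pencil w a 0) i = ((1 + 2 * w) * a)%:MP * tnth (F4oo_form R) i.
Proof.
by elim/ord3_ind: i; rewrite !(tnth_nth 0) /= mpolyCM mpolyC0; ring.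
Qed.

Lemma theta_neq0 : 1 + 2 * w != 0.
Proof.
apply: contraTneq n3 => t0; rewrite negbK.
have -> : (3%:R : C) = - (1 + 2 * w) ^+ 2 by ring: w3.
by rewrite t0 expr0n oppr0.
Qed.

Lemma H4oo_wronskian i :
  rf_den (H4oo R) * (rf_num (H4oo R))^`M(i) - rf_num (H4oo R) * (rf_den (H4oo R))^`M(i) =
  - 3%:R * tnth (F4oo_form R) i.
Proof.
rewrite /= !exprS !expr0 !mulr1 !mderivE.
by elim/ord3_ind: i; rewrite !(tnth_nth 0) /=; ring.
Qed.

(** If N o A = c (D o A), then the homogeneous polynomial N - c D is killed by composition with [A],
    hence zero because [A] is birational. *)
Lemma rf_pullback_nonconstant (A : birmap C) (H : ratfun C) :
  rf_nonconstant H -> rf_nonconstant (rf_pullback A H).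
Proof.
move=> nH [c hc]; apply: nH; exists c; apply/eqP; rewrite -subr_eq0.
have [d [hN hD]] := rf_homog H.
have hd : rf_num H - c *: rf_den H \is d.-homog by rewrite rpredB ?rpredZ.
apply: contraTT isT => n0; have := comp_neq0 A hd n0.
by rewrite comp_mpolyB comp_mpolyZ -hc subrr eqxx.
Qed.

Lemma H4oo_nonconstant : rf_nonconstant (H4oo R).
Proof.
(* At (0, 1, 0) the numerator is 1 and the denominator 0. *)
move=> [c] /(congr1 (meval (fun i : 'I_3 => (i == 1)%:R))) /=.
rewrite mevalZ !mevalB !rmorphXn /= !mevalXU /=.
rewrite !expr0n !expr1n subr0 subrr mulr0 => /eqP.
by rewrite oner_eq0.
Qed.
End Eisenstein.

Theorem mainTheorem10 (R : realType) (alpha lambda : R[i])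
    (a b : eisenstein) (M : nat) (q : nat -> eisenstein) (r : int -> eisenstein)
    (halpha : in_Qomega alpha)
    (hlambda : lambda = 3^-1 * (1 + 2 * omega R) * (1 - alpha))
    (hb : eis_val R b != 0)
    (hab : eis_coprime R a b)
    (hlab : lambda = - (eis_val R a / eis_val R b))
    (hrun : euclid_run R a b M q r) :
  let A := W4_comp R q M in
  maps_foliation A (F4 alpha) (F4oo R) /\
  rational_first_integral (F4oo R) (H4oo R) /\
  rational_first_integral (F4 alpha) (rf_pullback A (H4oo R)).
Proof.
move=> A.
have [_ rM0] := euclid_run_last hb hrun.
have [_ _ _ rM] := hrun.
have hA : carries (bir_map A) (F4_form alpha) (F4oo_form R).
  have := W4_comp_carries hrun (leqnn M); rewrite rM.
  (* The run ends at the pair (r_{M-1}, 0), whose form is c times that of F^4_oo. *)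
  set c := (1 + 2 * omega R) * eis_val R (r (M%:Z - 1)).
  have c0 : c != 0 by rewrite mulf_neq0 ?theta_neq0.
  apply: (carries_scale hb (invr_neq0 c0)).
    by apply: F4_pencil => //; rewrite -hlambda.
  by move=> i; rewrite F4oo_pencil mulrA -mpolyCM mulVf // mpolyC1 mul1r.
split; first exact: carries_maps.
split; split.
- exact: H4oo_nonconstant.
- exact: (@constant_on_leaves_wronskian _ (F4oo R) (H4oo R) (- 3%:R) (@H4oo_wronskian R)).
- exact/rf_pullback_nonconstant/H4oo_nonconstant.
have [h _ hh] := hA.
(* The multiplier is the pulled-back constant -3 times the factor h by which the pulled-back form of
   F^4_oo exceeds that of F^4_alpha. *)
apply: (@constant_on_leaves_wronskian _ _ _ ((- 3%:R \mPo bir_map A) * h)) => i.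
rewrite -mulrA -hh.
exact: (wronskian_comp (bir_map A) (@H4oo_wronskian R) i).
Qed.
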